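(* Let $d\ge 2$ be an integer and let $X$ be a $d$-dimensional real normed space. Then $X$ is Euclidean (its norm is induced by an inner product) if and only if every set of $d+1$ affine independent points of $X$ is a resolving set for the whole space $X$.
   Context: Let $X$ be a real normed space with norm $\|\cdot\|$ and let $R,S\subseteq X$. $R$ is a resolving set for $S$ if for any $s_1,s_2\in S$, the equations $\|r-s_1\|=\|r-s_2\|$ for all $r\in R$ imply $s_1=s_2$. *)

(* Defs.v *)
From HB Require Import structures.
From mathcomp Require Import all_boot all_order all_algebra.
From mathcomp Require Import boolp classical_sets cardinality reals.
From mathcomp Require Import topology normedtype.

Set Implicit Arguments.
Unset Strict Implicit.
Unset Printing Implicit Defensive.

Import Order.TTheory GRing.Theory Num.Theory.
Import numFieldNormedType.Exports.

Local Open Scope classical_set_scope.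
Local Open Scope ring_scope.

#[short(type="normedVectType")]
HB.structure Definition NormedVector (R : numFieldType) :=
  {X of NormedModule R X & Vector R X}.

(* The norm of X is induced by an inner product; over the real numbers, a form
   Hermitian for the identity automorphism is a symmetric bilinear form. *)
Definition euclidean (R : realType) (X : normedModType R) : Prop :=
  exists ip : {dot X for idfun}, forall x : X, `|x| ^+ 2 = ip x x.

Definition affine_independent (R : realType) (X : lmodType R) (A : set X) :
    Prop :=
  forall (n : nat) (p : 'I_n -> X) (c : 'I_n -> R),
    injective p -> (forall i, A (p i)) ->
    \sum_i c i = 0 -> \sum_i c i *: p i = 0 -> forall i, c i = 0.

Definition resolving (R : realType) (X : normedModType R) (A S : set X) :
    Prop :=
  forall s1 s2 : X, S s1 -> S s2 ->
    (forall r, A r -> `|r - s1| = `|r - s2|) -> s1 = s2.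

(* Main.v *)
From HB Require Import structures.
Require Import Defs.
From mathcomp Require Import all_boot all_order all_algebra.
From mathcomp Require Import boolp classical_sets cardinality reals.
From mathcomp Require Import topology normedtype.
From mathcomp Require Import finmap sesquilinear ring lra.

Set Implicit Arguments.
Unset Strict Implicit.
Unset Printing Implicit Defensive.

Import Order.TTheory GRing.Theory Num.Theory.
Import numFieldNormedType.Exports.

Local Open Scope classical_set_scope.
Local Open Scope card_scope.
Local Open Scope ring_scope.

(** A set fails to resolve [s1 <> s2] exactly when it lies in the bisector of
    [s1] and [s2], so the theorem says that a norm is Euclidean if and only if
    no bisector of two distinct points contains [dim X + 1] affinely independent
    points. In a Euclidean space the bisector of [s1] and [s2] is a hyperplane
    orthogonal to [s1 - s2]: if it contains [dim X + 1] affinely independent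
    points, their differences span [X], so [s1 - s2] is orthogonal to itself
    ([euclidean_resolving]).

    For the converse only the pairs [x], [-x] are needed. The points [y] with
    [`|y + x| = `|y - x|] are those isosceles-orthogonal to [x]; call the set of
    them [B x]. By the intermediate value theorem [B x] meets every line of
    direction [x] ([isosceles_meets_line]). It contains 0, so under the
    assumption on resolving sets it cannot contain [dim X] linearly independent
    vectors, and it spans a proper subspace [U]. Every vector is the sum of one
    in [B x] and a multiple of [x]; hence [x] is not in [U], the line through
    [u] in [U] can meet [B x] only at [u], and [B x] is equal to [U]
    ([isosceles_linear_resolving]).

    It remains to see that a norm for which every [B x] is a linear subspace is
    Euclidean ([euclidean_isosceles_linear]). Every [z] then has a unique
    decomposition [z = t *: x + h] with [h] in [B x], in which [t] is linear in
    [z]; the candidate for the inner product of [z] and [x] is [t * `|x| ^+ 2].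
    Only its symmetry is not immediate. If [`|x| = `|z|], then [x + z] is
    isosceles-orthogonal to [x - z], so the reflection that exchanges [x] and
    [z] preserves the norm of their combinations ([norm_swap]); it maps the
    decomposition of [z] along [x] to that of [x] along [z], which gives the
    same [t]. The general case follows by scaling. *)

(** * Isosceles orthogonality *)

Section Isosceles.
Context {R : realType} {X : normedModType R}.
Implicit Types (x y z u v : X) (a b t : R).

Definition isosceles x y := `|y + x| = `|y - x|.

Lemma isosceles0 x : isosceles x 0.
Proof. by rewrite /isosceles add0r sub0r normrN. Qed.

Lemma isosceles_self x : isosceles x x -> x = 0.
Proof.
rewrite /isosceles subrr normr0 => /normr0_eq0 /eqP.
by rewrite -mulr2n -scaler_nat scaler_eq0 pnatr_eq0 => /eqP.
Qed.

(** The function [t |-> `|z - t *: x|] tends to infinity on both sides, so it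
    cannot keep decreasing in steps of length 2 in either direction. Its
    difference over an interval of length 2 thus takes both signs, and a zero
    of that difference is a point of the line equidistant from [x] and [-x]. *)
Lemma isosceles_meets_line x z : x != 0 -> exists t, isosceles x (z - t *: x).
Proof.
move=> x0.
pose g t := `|z - t *: x|.
have gE t : `|z - t *: x + x| = g (t - 1).
  by rewrite /g scalerBl scale1r opprB addrA addrAC.
have gE' t : `|z - t *: x - x| = g (t + 1).
  by rewrite /g scalerDl scale1r opprD addrA.
suff [t gt] : exists t, g (t + 1) - g (t - 1) = 0.
  by exists t; rewrite /isosceles gE gE'; apply/esym/eqP; rewrite -subr_eq0 gt.
have g_cont : continuous g.
  move=> t; apply: cvg_norm; apply: cvgB; first exact: cvg_cst.
  by apply: cvgZr_tmp; exact: cvg_id.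
have x_gt0 : 0 < `|x| by rewrite normr_gt0.
have g_ge t : `|t| * `|x| - `|z| <= g t.
  by rewrite /g -normrZ distrC lerB_dist.
have g_incr s : `|s| = 2 -> exists n : nat, g (s * n%:R) <= g (s * n.+1%:R).
  move=> s2; apply: contrapT => /forallNP g_decr.
  have g_le n : g (s * n%:R) <= g 0.
    elim: n => [|n IHn]; first by rewrite mulr0.
    by apply: le_trans IHn; rewrite ltW // ltNge; apply/negP/g_decr.
  have C0 : 0 <= (g 0 + `|z|) / `|x| by rewrite divr_ge0// addr_ge0// normr_ge0.
  have := archi_boundP C0; set n := Num.Def.archi_bound _.
  rewrite ltr_pdivrMr// ltNge => /negP; apply.
  have := le_trans (g_ge _) (g_le n).
  rewrite normrM s2 normr_nat lerBlDr; apply: le_trans.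
  by rewrite ler_wpM2r// ler_peMl// ler1n.
pose h t := g (t + 1) - g (t - 1).
have shift_cont c : continuous (fun t => g (t + c)).
  move=> t; apply: (@continuous_comp _ _ _ (fun t => t + c) g); last first.
    exact: g_cont.
  by apply: cvgD; [exact: cvg_id | exact: cvg_cst].
have h_cont : continuous h by move=> t; apply: cvgB; exact: shift_cont.
have [t1 h1] : exists t, 0 <= h t.
  have [|n gn] := g_incr 2; first by rewrite ger0_norm.
  exists (2 * n%:R + 1); rewrite subr_ge0 addrK.
  by rewrite [X in _ <= g X](_ : _ = 2 * n.+1%:R) // -[n.+1%:R]natr1; lra.
have [t2 h2] : exists t, h t <= 0.
  have [|n gn] := g_incr (- 2); first by rewrite normrN ger0_norm.
  exists (- 2 * n%:R - 1); rewrite subr_le0 subrK.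
  by rewrite [X in _ <= g X](_ : _ = - 2 * n.+1%:R) // -[n.+1%:R]natr1; lra.
have zero a b : a <= b -> Num.min (h a) (h b) <= 0 <= Num.max (h a) (h b) ->
    exists t, h t = 0.
  move=> ab h0; have [|c _ hc] := IVT ab _ h0; last by exists c.
  exact: continuous_subspaceT.
have [t12|/ltW t21] := leP t1 t2.
  by apply: zero t12 _; rewrite ge_min le_max h1 h2 orbT.
by apply: zero t21 _; rewrite ge_min le_max h1 h2 orbT.
Qed.

(** * Norms with linear isosceles orthogonality *)

Hypothesis isosceles_linear : forall x, x != 0 -> forall a y z,
  isosceles x y -> isosceles x z -> isosceles x (a *: y + z).

(** Scaling [x] by [a] amounts to scaling [y] by [a^-1] and then both norms by
    [`|a|], so homogeneity in [y] gives homogeneity in [x]. *)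
Lemma isoscelesZ x y a b : isosceles x y -> isosceles (a *: x) (b *: y).
Proof.
move=> xy; have [->|a0] := eqVneq a 0.
  by rewrite /isosceles scale0r subr0 addr0.
have [->|x0] := eqVneq x 0; first by rewrite /isosceles scaler0 subr0 addr0.
have := isosceles_linear x0 (a^-1 * b) xy (isosceles0 x).
rewrite addr0 /isosceles => /(congr1 ( *%R `|a|)); rewrite -!normrZ.
by rewrite scalerDr scalerBr scalerA mulrA divff// mul1r.
Qed.

(** Ficken's condition. On the plane of [x] and [z] the exchange of the two
    vectors is the reflection that fixes [x + z] and negates [x - z]; these two
    vectors are isosceles-orthogonal because their sum and their difference are
    [2 *: x] and [2 *: z]. *)
Lemma norm_swap x z a b : `|x| = `|z| ->
  `|a *: x + b *: z| = `|b *: x + a *: z|.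
Proof.
move=> xz.
have uv : isosceles (x - z) (x + z).
  rewrite /isosceles opprB addrACA subrr addr0 [x + z]addrC addrACA subrr addr0.
  by rewrite -!mulr2n !normrMn xz.
have comb c e : c *: (x + z) + e *: (x - z) = (c + e) *: x + (c - e) *: z.
  by rewrite scalerDr scalerBr addrACA -scalerDl -scalerBl.
have := isoscelesZ ((a - b) / 2) ((a + b) / 2) uv.
rewrite /isosceles -scaleNr !comb.
have -> : (a + b) / 2 + (a - b) / 2 = a by lra.
have -> : (a + b) / 2 - (a - b) / 2 = b by lra.
by have -> : (a + b) / 2 - - ((a - b) / 2) = a by lra.
Qed.

(** The coefficient of [x] in the decomposition of [z] along the line of [x] and
    the vectors isosceles-orthogonal to [x]. *)
Definition isosceles_coord x z : R := xget 0 [set t | isosceles x (z - t *: x)].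

Lemma isosceles_coordP x z :
  x != 0 -> isosceles x (z - isosceles_coord x z *: x).
Proof. by move=> x0; apply: xgetPex (isosceles_meets_line z x0). Qed.

Lemma isosceles_coord_eq x z t :
  x != 0 -> isosceles x (z - t *: x) -> isosceles_coord x z = t.
Proof.
move=> x0 tP; have := isosceles_coordP z x0; set s := isosceles_coord x z => sP.
have := isosceles_linear x0 (-1) sP tP.
rewrite scaleN1r opprB -addrA [- z + _]addrA addNr add0r -scalerBl => stP.
apply/eqP; rewrite -subr_eq0; apply: contraTT x0 => st0; apply/negPn/eqP.
apply: isosceles_self; have := isoscelesZ 1 (s - t)^-1 stP.
by rewrite scalerA mulVf// !scale1r.
Qed.

Lemma isosceles_coord_linear x a y z : x != 0 ->
  isosceles_coord x (a *: y + z) =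
  a * isosceles_coord x y + isosceles_coord x z.
Proof.
move=> x0; apply: isosceles_coord_eq => //.
have := isosceles_linear x0 a (isosceles_coordP y x0) (isosceles_coordP z x0).
by rewrite scalerBr scalerA addrACA -opprD -scalerDl.
Qed.

Lemma isosceles_coord0 x : x != 0 -> isosceles_coord x 0 = 0.
Proof.
move=> x0; apply: isosceles_coord_eq => //.
by rewrite scale0r subr0; exact: isosceles0.
Qed.

Lemma isosceles_coord_self x : x != 0 -> isosceles_coord x x = 1.
Proof.
move=> x0; apply: isosceles_coord_eq => //.
by rewrite scale1r subrr; exact: isosceles0.
Qed.

Lemma isosceles_coordZ x z a : x != 0 -> a != 0 ->
  isosceles_coord (a *: x) z = a^-1 * isosceles_coord x z.
Proof.
move=> x0 a0; apply: isosceles_coord_eq; first by rewrite scaler_eq0 negb_or a0.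
rewrite scalerA mulrAC mulVf// mul1r -[z - _]scale1r.
exact/isoscelesZ/isosceles_coordP.
Qed.

(** The exchange of [x] and [z] maps the condition that [z - t *: x] is
    isosceles-orthogonal to [x] to the condition that [x - t *: z] is
    isosceles-orthogonal to [z]. *)
Lemma isosceles_coord_swap x z : x != 0 -> `|x| = `|z| ->
  isosceles_coord z x = isosceles_coord x z.
Proof.
move=> x0 xz; have z0 : z != 0 by rewrite -normr_eq0 -xz normr_eq0.
apply: isosceles_coord_eq => //.
have := isosceles_coordP z x0; set t := isosceles_coord x z.
have comb u v c : v - t *: u + c *: u = (c - t) *: u + 1 *: v.
  by rewrite scale1r addrAC -addrA -scalerBl addrC.
have combD u v : v - t *: u + u = (1 - t) *: u + 1 *: v.
  by rewrite -comb scale1r.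
have combB u v : v - t *: u - u = (- 1 - t) *: u + 1 *: v.
  by rewrite -comb scaleN1r.
rewrite /isosceles !combD !combB.
rewrite [in X in X = _ -> _](norm_swap _ _ xz).
rewrite [in X in _ = X -> _](norm_swap _ _ xz).
by rewrite ![1 *: _ + _]addrC.
Qed.

Definition isosceles_form z x : R := isosceles_coord x z * `|x| ^+ 2.

Lemma isosceles_formC x z : isosceles_form x z = isosceles_form z x.
Proof.
rewrite /isosceles_form.
have [->|x0] := eqVneq x 0.
  have [->|z0] := eqVneq z 0; first by [].
  by rewrite isosceles_coord0// normr0 expr0n mul0r mulr0.
have [->|z0] := eqVneq z 0.
  by rewrite isosceles_coord0// normr0 expr0n mul0r mulr0.
have nx : `|x| != 0 by rewrite normr_eq0.
have nz : `|z| != 0 by rewrite normr_eq0.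
(* The multiple [c *: z] has the norm of [x], so the two can be exchanged. *)
pose c := `|x| / `|z|.
have c0 : c != 0 by rewrite mulf_neq0 ?invr_eq0.
have cz : `|x| = `|c *: z|.
  by rewrite normrZ normrM normfV !normr_id divfK.
have := isosceles_coord_swap x0 cz.
rewrite isosceles_coordZ// -[c *: z]addr0 isosceles_coord_linear//.
rewrite isosceles_coord0// addr0 /c invf_div.
move: (isosceles_coord _ _) (isosceles_coord _ _) => p q pq.
have -> : p = `|z| / `|x| * (`|x| / `|z| * p) by field; rewrite nx nz.
by rewrite -pq; field.
Qed.

Lemma euclidean_isosceles_linear : euclidean X.
Proof.
have form_linear x : GRing.linear_for *%R (isosceles_form^~ x).
  move=> a y z; rewrite /isosceles_form.
  have [->|x0] := eqVneq x 0; first by rewrite normr0 expr0n !mulr0 addr0.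
  by rewrite isosceles_coord_linear// mulrDl -mulrA.
have form_norm x : isosceles_form x x = `|x| ^+ 2.
  rewrite /isosceles_form.
  have [->|x0] := eqVneq x 0; first by rewrite normr0 expr0n mulr0.
  by rewrite isosceles_coord_self// mul1r.
have form_bilinear : bilinear_for *%R (idfun \; *%R) isosceles_form.
  split=> x a y z; first exact: form_linear.
  by rewrite /= !(isosceles_formC x); exact: form_linear.
have form_pos x : x != 0 -> 0 < isosceles_form x x.
  by move=> x0; rewrite form_norm exprn_gt0// normr_gt0.
have form_herm x y :
    isosceles_form x y = (-1) ^+ false * idfun (isosceles_form y x).
  by rewrite expr0 mul1r isosceles_formC.
pose bil := bilinear_isBilinear.Build R X X R _ _ isosceles_form form_bilinear.
pose dot := isDotProduct.Build R X isosceles_form form_pos.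
pose herm := isHermitianSesquilinear.Build R X false idfun isosceles_form
  form_herm.
pose F : {dot X for idfun} := HB.pack isosceles_form bil herm dot.
by exists F => x; rewrite -form_norm.
Qed.

End Isosceles.

(** * Resolving sets in finite dimension *)

Section FiniteDimension.
Context {R : realType} {X : normedVectType R}.
Implicit Types (x y : X) (s : seq X).

Lemma affine_independent_cons0 s :
  free s -> affine_independent [set` 0 :: s].
Proof.
move=> s_free n p c p_inj p_in c_sum cp_sum.
have c_off i : p i != 0 -> c i = 0.
  move=> pi0; have pis : p i \in s.
    by have /= := p_in i; rewrite inE (negPf pi0).
  (* The coordinate form dual to [p i] vanishes on all the other points. *)
  have idx : (index (p i) s < size s)%N by rewrite index_mem.
  have coordE j : coord (in_tuple s) (Ordinal idx) (p j) = (j == i)%:R.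
    have /= := p_in j; rewrite inE => /orP[/eqP pj0|pjs].
      by rewrite pj0 linear0; case: eqP => // ji; rewrite -ji pj0 eqxx in pi0.
    have jdx : (index (p j) s < size s)%N by rewrite index_mem.
    rewrite -{1}(nth_index 0 pjs).
    rewrite (coord_free (X := in_tuple s) (Ordinal jdx) (Ordinal idx))//.
    congr (nat_of_bool _)%:R; rewrite -val_eqE /=.
    apply/eqP/eqP => [ij|->//]; apply: p_inj.
    by rewrite -(nth_index 0 pjs) ij nth_index.
  have /(congr1 (coord (in_tuple s) (Ordinal idx))) := cp_sum.
  rewrite linear0 linear_sum (bigD1 i)//= big1 => [|j ji].
    by rewrite linearZ /= coordE eqxx addr0 mulr1.
  by rewrite linearZ /= coordE (negPf ji) mulr0.
move=> i; have [pi0|] := eqVneq (p i) 0; last exact: c_off.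
move: c_sum; rewrite (bigD1 i)//= big1 ?addr0// => j ji; apply: c_off.
by rewrite -pi0 (inj_eq p_inj).
Qed.

Lemma card_set_seq (T : choiceType) (s : seq T) :
  uniq s -> [set` s] #= `I_(size s).
Proof.
move=> s_uniq; have <- : [set` seq_fset tt s] = [set` s].
  by apply/predeqP => x; split=> /=; rewrite (seq_fsetE tt s x).
by apply/card_eq_fsetP; rewrite size_seq_fset undup_id.
Qed.

Hypothesis resolvingX : forall A : set X, A #= `I_(\dim {:X}).+1 ->
  affine_independent A -> resolving A [set: X].

(** A basis isosceles-orthogonal to [x], together with 0, would be an affinely
    independent set of [dim X + 1] points equidistant from [x] and [-x]. *)
Lemma isosceles_free_lt s x : x != 0 -> free s ->
  {in s, forall y, isosceles x y} -> (size s < \dim {:X})%N.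
Proof.
move=> x0 s_free s_iso.
have s_le : (size s <= \dim {:X})%N by rewrite -(eqP s_free) dimvS// subvf.
rewrite ltn_neqAle s_le andbT; apply: contra x0 => /eqP sX.
apply/eqP/isosceles_self/esym.
rewrite /isosceles subrr normr0.
have s0_uniq : uniq (0 :: s).
  rewrite /= free_uniq// andbT; apply/negP => /(free_not0 s_free).
  by rewrite eqxx.
have card0s : [set` 0 :: s] #= `I_(\dim {:X}).+1.
  by rewrite -sX; exact: (card_set_seq s0_uniq).
have : x = - x; last by move=> {1}->; rewrite addNr normr0.
apply: (resolvingX card0s (affine_independent_cons0 s_free)) => // r.
rewrite /= opprK inE => /orP[/eqP ->|rs]; last exact/esym/s_iso.
by rewrite !add0r normrN.
Qed.

(** The vectors isosceles-orthogonal to [x] are the span of a maximal free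
    family among them: the span is proper, so it does not contain [x], and any
    [v] in the span differs from an isosceles-orthogonal vector by a multiple of
    [x] that lies in the span, hence is 0. *)
Lemma isosceles_linear_resolving x a y z : x != 0 ->
  isosceles x y -> isosceles x z -> isosceles x (a *: y + z).
Proof.
move=> x0 xy xz.
pose P n := `[< exists s, [/\ size s = n, free s &
                            {in s, forall y, isosceles x y}] >].
have P0 : exists n, P n.
  by exists 0%N; apply/asboolP; exists [::]; rewrite nil_free.
have P_le n : P n -> (n <= \dim {:X})%N.
  move=> /asboolP[s [<- s_free s_iso]].
  exact/ltnW/(isosceles_free_lt x0 s_free s_iso).
case: (ex_maxnP P0 P_le) => n /asboolP[s [sn s_free s_iso]] n_max.
have s_lt := isosceles_free_lt x0 s_free s_iso.
have iso_span v : isosceles x v -> v \in <<s>>%VS.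
  move=> xv; apply: contraT => vs.
  suff /n_max : P n.+1 by rewrite ltnn.
  apply/asboolP; exists (v :: s); rewrite /= sn free_cons vs; split=> // w.
  by rewrite inE => /orP[/eqP ->//|/s_iso].
have xNs : x \notin <<s>>%VS.
  apply: contraL s_lt => xs; rewrite -leqNgt -(eqP s_free) dimvS//.
  apply/subvP => v _; have [t /iso_span tv] := isosceles_meets_line v x0.
  by rewrite -(subrK (t *: x) v) rpredD// rpredZ.
suff span_iso v : v \in <<s>>%VS -> isosceles x v.
  by apply: span_iso; rewrite rpredD ?rpredZ ?iso_span.
move=> vs; have [t tv] := isosceles_meets_line v x0.
have : t *: x \in <<s>>%VS.
  by rewrite -[t *: x](subKr v) rpredB// iso_span.
have [t0|t0 txs] := eqVneq t 0; first by rewrite t0 scale0r subr0 in tv.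
by move: xNs; rewrite -[x](scalerK t0) rpredZ.
Qed.

End FiniteDimension.

(** The inner product with [w = s1 - s2] is constant on the points equidistant
    from [s1] and [s2]. The differences of [dim X + 1] affinely independent such
    points form a basis orthogonal to [w], so [w] is orthogonal to itself. *)
Lemma euclidean_resolving (R : realType) (X : normedVectType R) (A : set X) :
  euclidean X -> A #= `I_(\dim {:X}).+1 -> affine_independent A ->
  resolving A [set: X].
Proof.
move=> [ip ip_norm] /card_esym/card_set_bijP[f [fA f_inj _]] A_ind.
move=> s1 s2 _ _ s12.
set d := \dim {:X} in f_inj fA *.
pose p (i : 'I_d.+1) : X := f i.
have pA i : A (p i) by apply: fA => /=.
have p_inj : injective p.
  by move=> i j /f_inj ij; apply/val_inj/ij; exact/mem_set/ltn_ord.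
pose w := s1 - s2.
have ipC x y : ip x y = ip y x by rewrite hermitian_subproof expr0 mul1r.
have ipB r :
    ip r w * 2 =
    `|s1| ^+ 2 - `|s2| ^+ 2 + (`|r - s2| ^+ 2 - `|r - s1| ^+ 2).
  have sqB s : `|r - s| ^+ 2 = ip r r - ip r s * 2 + ip s s.
    rewrite ip_norm linearBr /= !linearBl /= (ipC s r); lra.
  rewrite !sqB !ip_norm linearBr /=; lra.
pose e : d.-tuple X := [tuple p (lift ord0 i) - p ord0 | i < d].
have eE (i : 'I_d) : e`_i = p (lift ord0 i) - p ord0 by rewrite nth_mktuple.
have e_free : free e.
  apply/freeP => k; under eq_bigr do rewrite eE; move=> ke i.
  (* Affine coefficients must sum to 0, which fixes the one of the base point. *)
  pose c j := oapp k (- \sum_j k j) (unlift ord0 j).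
  have c0 : c ord0 = - \sum_j k j by rewrite /c unlift_none.
  have cS j : c (lift ord0 j) = k j by rewrite /c liftK.
  rewrite -cS; apply: (A_ind _ p) => //; rewrite big_ord_recl c0.
    by under [X in _ + X]eq_bigr do rewrite cS; rewrite addNr.
  under [X in _ + X]eq_bigr do rewrite cS.
  rewrite -[RHS]ke; under [RHS]eq_bigr do rewrite scalerBr.
  by rewrite sumrB -scaler_suml scaleNr addrC.
have w_span : w \in <<e>>%VS.
  suff -> : <<e>>%VS = fullv by rewrite memvf.
  by apply/eqP; rewrite eqEdim subvf (eqP e_free) size_tuple leqnn.
have w0 : ip w w = 0.
  have ip_coord : ip w w = \sum_i coord e i w * ip w e`_i.
    by rewrite {2}(coord_span w_span) linear_sumr; apply: eq_bigr => i _;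
      rewrite linearZr_LR.
  rewrite ip_coord big1// => i _; rewrite eE linearBr /= !(ipC w).
  have := ipB (p ord0); have := ipB (p (lift ord0 i)).
  rewrite !s12// => ip1 ip0.
  have -> : ip (p (lift ord0 i)) w - ip (p ord0) w = 0 by lra.
  by rewrite mulr0.
by apply/eqP; rewrite -subr_eq0 -normr_eq0 -sqrf_eq0 ip_norm w0.
Qed.

Theorem corollary3 (R : realType) (d : nat) (hd : (2 <= d)%N)
    (X : normedVectType R) (dimX : \dim {:X} = d) :
  euclidean X <->
  (forall A : set X, A #= `I_d.+1 -> affine_independent A ->
     resolving A [set: X]).
Proof.
rewrite -dimX; split=> [X_eucl A|X_res]; first exact: euclidean_resolving.
apply: euclidean_isosceles_linear => x x0 a y z.
exact: isosceles_linear_resolving.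
Qed.
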